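(* Let $k$ be an algebraically closed field of characteristic $0$ and $\alpha$ a $k$-valued pseudocharacter (pseudo-TQFT) of $\mathrm{Cob}_2$. Then $Z_\alpha(T)$ is rational and has one of the forms (1) $Z_\alpha=\mu+mT+\sum_{i=1}^s\frac{m_i\lambda_i^{-1}}{1-\lambda_iT}$ with $\mu\in k$, $m\in\{2,3,\dots\}$, $s\ge0$, $m_i\in\{1,2,\dots\}$, $\lambda_i\in k^\times$; (2) $Z_\alpha=\sum_{i=1}^s\frac{m_i\lambda_i^{-1}}{1-\lambda_iT}$ with $s\ge0$, $m_i\in\{1,2,\dots\}$, $\lambda_i\in k^\times$. In particular there exists a finite-dimensional commutative Frobenius algebra $(B,\varepsilon)$ over $k$ (possibly zero) such that $\alpha(S_g)=\varepsilon(h_B^g)$ for all $g\ge0$, i.e. $\alpha$ is the restriction to closed surfaces of the two-dimensional TQFT determined by $(B,\varepsilon)$.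
   Context: $\mathrm{Cob}_2$ is the rigid symmetric monoidal category of oriented two-dimensional cobordisms between closed oriented one-manifolds, with unit the empty manifold $\emptyset$. An evaluation is a monoid homomorphism $\alpha:\mathrm{End}_{\mathrm{Cob}_2}(\emptyset)\to k$ ($\alpha(\emptyset)=1$, multiplicative on disjoint unions); it is determined by $\alpha_g:=\alpha(S_g)$, $S_g$ the closed connected oriented genus-$g$ surface, and $Z_\alpha(T)=\sum_{g\ge0}\alpha_gT^g$ (rational functions identified with their expansions at $T=0$). Extend $\alpha$ linearly. For an object $N$ and $n\ge1$, $e^-_{N,n}=\sum_{\sigma\in S_n}\mathrm{sgn}(\sigma)\sigma\in k\,\mathrm{End}(N^{\sqcup n})$ via permutation cobordisms; $\mathrm{cl}(f)$ denotes the closure (categorical trace) of an endomorphism $f$. $\deg_\alpha(N)$ is the least $d\ge0$ with $\alpha(\mathrm{cl}(h\circ e^-_{N,d+1}))=0$ for all $h\in\mathrm{End}_{\mathrm{Cob}_2}(N^{\sqcup(d+1)})$ ($\infty$ if none); $\alpha$ is a pseudocharacter of $\mathrm{Cob}_2$ if $\deg_\alpha(N)<\infty$ for every object $N$. A commutative Frobenius algebra $(B,\varepsilon)$ is a finite-dimensional commutative $k$-algebra with $k$-linear $\varepsilon:B\to k$ such that $(x,y)\mapsto\varepsilon(xy)$ is nondegenerate; its handle element is $h_B=\sum_iu_iv_i$ for a basis $\{u_i\}$ and dual basis $\{v_i\}$ with $\varepsilon(u_iv_j)=\delta_{ij}$. *)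

(* Defs.v *)
From HB Require Import structures.
From mathcomp Require Import all_boot all_order all_fingroup all_algebra.
Set Implicit Arguments. Unset Strict Implicit. Unset Printing Implicit Defensive.
Import Order.TTheory GRing.Theory Num.Theory.
Local Open Scope ring_scope.

(* Combinatorial model of Cob_2 (classification of compact oriented    *)
(* surfaces).  An object is N = n circles.  The object N^{⊔(d+1)} has  *)
(* its circles indexed by ('I_(d+1) * 'I_n) (copy i, circle a).        *)
(* An endomorphism h of N^{⊔(d+1)} is presented by                     *)
(*   - a finite set 'I_K of connected components,                      *)
(*   - cin i a  : the component containing incoming circle (i,a),       *)
(*   - cout i a : the component containing outgoing circle (i,a),       *)
(*   - gen c    : the genus of component c                             *)
(* (components hit by no boundary circle are the closed components).   *)
(* Every such datum is a cobordism and every cobordism has such a      *)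
(* presentation.                                                       *)
(* An evaluation alpha is determined by alpha_g = alpha(S_g); we take  *)
(* alpha : nat -> k and evaluate a closed surface as the product of    *)
(* alpha over the genera of its connected components.                  *)
(* The permutation cobordism of s in S_(d+1) sends incoming copy i to  *)
(* outgoing copy s i.  In cl(h o s) the outgoing circle (i,a) of h is  *)
(* glued to the incoming circle (s i, a) of h.                         *)

Section Cob2.
Variable k : fieldType.

Definition glue_rel (n d K : nat) (cin cout : 'I_d.+1 -> 'I_n -> 'I_K)
    (s : 'S_d.+1) : rel 'I_K :=
  fun u v => [exists i : 'I_d.+1, exists a : 'I_n,
      ((cout i a == u) && (cin (s i) a == v))
   || ((cout i a == v) && (cin (s i) a == u))].

(* connected components of the closed surface cl(h o s) *)
Definition glue_classes (n d K : nat) (cin cout : 'I_d.+1 -> 'I_n -> 'I_K)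
    (s : 'S_d.+1) : {set {set 'I_K}} :=
  [set [set u | connect (glue_rel cin cout s) v u] | v : 'I_K].

(* genus of a glued connected component C: sum of genera of its pieces *)
(* + number of gluing circles in C + 1 - number of pieces              *)
Definition glue_genus (n d K : nat) (cout : 'I_d.+1 -> 'I_n -> 'I_K)
    (gen : 'I_K -> nat) (C : {set 'I_K}) : nat :=
  ((\sum_(v in C) gen v)
     + #|[set ia : 'I_d.+1 * 'I_n | cout ia.1 ia.2 \in C]| + 1 - #|C|)%N.

Definition closure_eval (alpha : nat -> k) (n d K : nat)
    (cin cout : 'I_d.+1 -> 'I_n -> 'I_K) (gen : 'I_K -> nat)
    (s : 'S_d.+1) : k :=
  \prod_(C in glue_classes cin cout s) alpha (glue_genus cout gen C).

Definition alt_closure_eval (alpha : nat -> k) (n d K : nat)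
    (cin cout : 'I_d.+1 -> 'I_n -> 'I_K) (gen : 'I_K -> nat) : k :=
  \sum_(s : 'S_d.+1) (-1) ^+ s * closure_eval alpha cin cout gen s.

Definition alt_vanishes (alpha : nat -> k) (n d : nat) : Prop :=
  forall (K : nat) (cin cout : 'I_d.+1 -> 'I_n -> 'I_K) (gen : 'I_K -> nat),
    alt_closure_eval alpha cin cout gen = 0.

(* deg_alpha(N) < oo for every object N (the least such d exists iff *)
(* some such d exists)                                                *)
Definition pseudocharacter (alpha : nat -> k) : Prop :=
  forall n : nat, exists d : nat, alt_vanishes alpha n d.

(* Coefficient of T^g in sum_i m_i lambda_i^{-1} / (1 - lambda_i T)    *)
Definition geom_part (s : seq (nat * k)) (g : nat) : k :=
  \sum_(p <- s) p.1%:R * p.2^-1 * p.2 ^+ g.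

Definition geom_data_ok (s : seq (nat * k)) : bool :=
  all (fun p => (0 < p.1)%N && (p.2 != 0)) s.

Definition Z_form1 (alpha : nat -> k) : Prop :=
  exists (mu : k) (m : nat) (s : seq (nat * k)),
    [/\ (2 <= m)%N, geom_data_ok s &
        forall g : nat,
          alpha g = (g == 0%N)%:R * mu + (g == 1%N)%:R * m%:R + geom_part s g].

Definition Z_form2 (alpha : nat -> k) : Prop :=
  exists s : seq (nat * k),
    geom_data_ok s /\ forall g : nat, alpha g = geom_part s g.

Record comFrobAlg := ComFrobAlg {
  fdim : nat;
  fmul : 'rV[k]_fdim -> 'rV[k]_fdim -> 'rV[k]_fdim;
  fone : 'rV[k]_fdim;
  feps : 'rV[k]_fdim -> k;
  fmul_linl : forall (a : k) x1 x2 y,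
      fmul (a *: x1 + x2) y = a *: fmul x1 y + fmul x2 y;
  fmulC : forall x y, fmul x y = fmul y x;
  fmulA : forall x y z, fmul x (fmul y z) = fmul (fmul x y) z;
  fmul1 : forall x, fmul fone x = x;
  feps_lin : forall (a : k) x y, feps (a *: x + y) = a * feps x + feps y;
  feps_nondeg : forall x, (forall y, feps (fmul x y) = 0) -> x = 0
}.

Definition is_dual_basis (B : comFrobAlg) (v : 'I_(fdim B) -> 'rV[k]_(fdim B))
  : Prop :=
  forall i j : 'I_(fdim B), feps (fmul (delta_mx 0 i) (v j)) = (i == j)%:R.

Definition handle (B : comFrobAlg) (v : 'I_(fdim B) -> 'rV[k]_(fdim B))
  : 'rV[k]_(fdim B) :=
  \sum_(i < fdim B) fmul (delta_mx 0 i) (v i).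

Definition fpow (B : comFrobAlg) (x : 'rV[k]_(fdim B)) (g : nat) :=
  iter g (fmul x) (fone B).

End Cob2.

(* Main.v *)
(* Only endomorphisms of disjoint unions of single circles are needed.  On d + 1
   circles take a tube of genus w_i on the i-th strand and cut strand 0 into two
   discs.  Closing up along a permutation s turns each cycle c of s into a
   closed surface of genus [0 notin c] + sum_(i in c) w_i, so extending
   multilinearly to polynomials a_i in the handle operator X gives
     sum_s sgn(s) prod_c L(X^[0 notin c] prod_(i in c) a_i) = 0,  L(X^g) = alpha_g.
   Together with sum_s sgn(s) x^#cycles(s) = x(x - 1)...(x - d) this yields, by
   choosing the a_i:
   - (p, X, ..., X): a nonzero polynomial q with L(q p) = 0 for all p;
   - (X z, z, ..., z) with z nilpotent modulo q: L(X z) = 0;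
   - (X e, e, ..., e) with e a Lagrange idempotent: L(X e) is a natural number.
   Hence alpha_(g+1) = sum_x m_x x^g with natural m_x.  For the idempotent e of
   the generalised eigenvalue 0, with m = L(X e) and mu = L(e), the choice
   (e, ..., e) gives mu = 0 when m = 0, and inserting one further X on an uncut
   strand excludes m = 1. *)

Require Import Defs.
From HB Require Import structures.
From mathcomp Require Import all_boot all_order all_fingroup all_algebra.
From mathcomp Require Import ring zify.
Import GRing.Theory.
Set Implicit Arguments. Unset Strict Implicit. Unset Printing Implicit Defensive.
Local Open Scope ring_scope.

(** * Closed surface values of Frobenius algebras *)

Section Realizable.
Variable k : fieldType.
Implicit Type alpha : nat -> k.

Definition frob_realizable alpha : Prop :=
  exists (B : comFrobAlg k) (v : 'I_(fdim B) -> 'rV[k]_(fdim B)),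
    is_dual_basis v /\ forall g, alpha g = feps (fpow (handle v) g).

Lemma frob_realizable_ext alpha beta :
  alpha =1 beta -> frob_realizable alpha -> frob_realizable beta.
Proof.
by move=> eab [B [v [dv va]]]; exists B, v; split=> // g; rewrite -eab.
Qed.

Lemma feps0 (B : comFrobAlg k) : feps (0 : 'rV[k]_(fdim B)) = 0.
Proof.
by have := feps_lin (-1) (0 : 'rV[k]_(fdim B)) 0; rewrite scaler0 addr0 mulN1r addNr.
Qed.

Lemma fmul0 (B : comFrobAlg k) (y : 'rV[k]_(fdim B)) : fmul 0 y = 0.
Proof.
by have := fmul_linl (-1) 0 0 y; rewrite scaler0 addr0 scaleN1r addNr.
Qed.

Lemma frob_realizable0 : frob_realizable (fun=> 0).
Proof.
pose B := @ComFrobAlg k 0 (fun x _ => x) 0 (fun=> 0).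
unshelve eexists (B _ _ _ _ _ _).
- by [].
- by move=> x y; rewrite !thinmx0.
- by move=> x y z; rewrite !thinmx0.
- by move=> x; rewrite !thinmx0.
- by move=> *; rewrite mulr0 addr0.
- by move=> x _; rewrite thinmx0.
by exists (fun=> 0); split=> // -[].
Qed.

(** The algebra is [k] with [feps 1 = lambda^-1]; the basis vector [1] has dual [lambda], which is
    therefore the handle element. *)
Lemma frob_realizable1 (lambda : k) : lambda != 0 ->
  frob_realizable (fun g => lambda^-1 * lambda ^+ g).
Proof.
move=> nz.
have E (x : 'rV[k]_1) : x = (x 0 0)%:M by exact: mx11_scalar.
pose B := @ComFrobAlg k 1 (fun x y => x 0 0 *: y) 1%:M
  (fun x => lambda^-1 * x 0 0).
unshelve eexists (B _ _ _ _ _ _).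
- by move=> a x1 x2 y /=; rewrite !mxE scalerDl scalerA.
- by move=> x y; apply/rowP=> i; rewrite !mxE !ord1 mulrC.
- by move=> x y z; apply/rowP=> i; rewrite !mxE !ord1 mulrA.
- by move=> x /=; rewrite mxE /= scale1r.
- by move=> a x y /=; rewrite !mxE; ring.
- move=> x /(_ 1%:M) /= /eqP; rewrite !mxE /= mulr1 mulf_eq0 invr_eq0 (negPf nz) /=.
  by move/eqP=> x0; rewrite (E x) x0 raddf0.
set C := B _ _ _ _ _ _; exists (fun=> lambda%:M); split.
  move=> i j; rewrite /= !ord1 !mxE /= mul1r mulVf //.
have hE : handle (B := C) (fun=> lambda%:M) = lambda%:M.
  by rewrite /handle /= big_ord_recl big_ord0 addr0 !mxE /= scale1r.
move=> g; rewrite hE /=; congr (_ * _).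
elim: g => [|g IHg] /=; first by rewrite expr0 mxE.
by rewrite exprS IHg !mxE.
Qed.

(** Take the direct product: the two dual bases concatenate, so the handle element is the pair of
    handle elements. *)
Lemma frob_realizableD alpha beta : frob_realizable alpha ->
  frob_realizable beta -> frob_realizable (fun g => alpha g + beta g).
Proof.
move=> [B1 [v1 [d1 e1]]] [B2 [v2 [d2 e2]]].
pose B := @ComFrobAlg k (fdim B1 + fdim B2)
  (fun x y => row_mx (fmul (lsubmx x) (lsubmx y)) (fmul (rsubmx x) (rsubmx y)))
  (row_mx (fone B1) (fone B2))
  (fun x => feps (lsubmx x) + feps (rsubmx x)).
unshelve eexists (B _ _ _ _ _ _).
- move=> a x1 x2 y /=; rewrite scale_row_mx add_row_mx -!fmul_linl.
  by congr (row_mx (fmul _ _) (fmul _ _)); apply/rowP=> i; rewrite !mxE.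
- by move=> x y /=; rewrite fmulC [in X in row_mx _ X]fmulC.
- by move=> x y z /=; rewrite !row_mxKl !row_mxKr !fmulA.
- by move=> x /=; rewrite !row_mxKl !row_mxKr !fmul1 hsubmxK.
- move=> a x y /=; rewrite !linearP !feps_lin; ring.
- move=> x /= xP; rewrite -[x]hsubmxK.
  have -> : lsubmx x = 0.
      apply: feps_nondeg => y; have := xP (row_mx y 0).
      by rewrite !row_mxKl !row_mxKr [fmul (rsubmx _) _]fmulC fmul0 feps0 addr0.
    have -> : rsubmx x = 0.
      apply: feps_nondeg => y; have := xP (row_mx 0 y).
      by rewrite !row_mxKl !row_mxKr [fmul (lsubmx _) _]fmulC fmul0 feps0 add0r.
    exact: row_mx0.
set C := B _ _ _ _ _ _.
pose v (i : 'I_(fdim B1 + fdim B2)) : 'rV[k]_(fdim B1 + fdim B2) :=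
  match split i with inl i => row_mx (v1 i) 0 | inr i => row_mx 0 (v2 i) end.
have vl i : v (lshift _ i) = row_mx (v1 i) 0 by rewrite /v -[lshift _ _]/(unsplit (inl i)) unsplitK.
have vr i : v (rshift _ i) = row_mx 0 (v2 i) by rewrite /v -[rshift _ _]/(unsplit (inr i)) unsplitK.
have dl i : delta_mx 0 (lshift (fdim B2) i) = row_mx (delta_mx 0 i) 0 :> 'rV[k]__.
  by rewrite delta_mx_lshift.
have dr i : delta_mx 0 (rshift (fdim B1) i) = row_mx 0 (delta_mx 0 i) :> 'rV[k]__.
  by rewrite delta_mx_rshift.
exists v; split.
  move=> i j /=; rewrite -(splitK i) -(splitK j).
  case: (split i) => i'; case: (split j) => j' /=;
    rewrite ?vl ?vr ?dl ?dr !row_mxKl !row_mxKr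
      ?[fmul _ 0]fmulC ?fmul0 ?feps0 ?addr0 ?add0r ?eq_lshift ?eq_rshift
      ?eq_lrshift ?eq_rlshift //.
have hE : handle (B := C) v = row_mx (handle v1) (handle v2).
  rewrite /handle /= big_split_ord /=.
  under eq_bigr => i _ do rewrite vl dl !row_mxKl !row_mxKr fmul0.
  under [X in _ + X]eq_bigr => i _ do rewrite vr dr !row_mxKl !row_mxKr fmul0.
  apply/rowP=> i; rewrite -(splitK i).
  case: (split i) => i' /=; rewrite ?row_mxEl ?row_mxEr mxE !summxE.
    under eq_bigr => j _ do rewrite row_mxEl.
    under [X in _ + X]eq_bigr => j _ do rewrite row_mxEl mxE.
    by rewrite big1_eq addr0.
  under eq_bigr => j _ do rewrite row_mxEr mxE.
  under [X in _ + X]eq_bigr => j _ do rewrite row_mxEr.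
  by rewrite big1_eq add0r.
move=> g; rewrite hE.
have -> : fpow (B := C) (row_mx (handle v1) (handle v2)) g =
    row_mx (fpow (handle v1) g) (fpow (handle v2) g).
  by elim: g => //= g ->; rewrite !row_mxKl !row_mxKr.
by rewrite /= row_mxKl row_mxKr e1 e2.
Qed.

(* The algebra spanned by 1, v_1, ..., v_n, w with v_i v_j = delta_ij w, w in
   the socle, eps w = 1 and eps 1 = mu; its handle element is (n + 2) w. *)
Lemma frob_realizable_local (mu : k) (n : nat) :
  frob_realizable (fun g => (g == 0%N)%:R * mu + (g == 1%N)%:R * n.+2%:R).
Proof.
pose V := 'rV[k]_(n.+2); pose mid (i : 'I_n.+2) := (i != ord0) && (i != ord_max).
pose b (x y : V) := \sum_(i | mid i) x 0 i * y 0 i.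
pose u : V := delta_mx 0 ord0; pose w : V := delta_mx 0 ord_max.
(* The first two terms both contain the product of the unit coordinates times [u], hence the
   subtraction. *)
pose mul (x y : V) : V := x 0 ord0 *: y + y 0 ord0 *: x
   - (x 0 ord0 * y 0 ord0) *: u + b x y *: w.
pose eps (x : V) := x 0 ord_max + mu * x 0 ord0.
have n0 : ord0 == ord_max :> 'I_n.+2 = false by [].
have bC x y : b x y = b y x by apply: eq_bigr => i _; rewrite mulrC.
have bl a x1 x2 y : b (a *: x1 + x2) y = a * b x1 y + b x2 y.
  rewrite mulr_sumr -big_split; apply: eq_bigr => i _.
  by rewrite !mxE mulrDl mulrA.
have bd i y : b (delta_mx 0 i) y = (mid i)%:R * y 0 i.
  rewrite /b; case: (boolP (mid i)) => mi.
    rewrite (bigD1 i) //= big1 => [|j /andP[_ /negPf ji]];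
      by rewrite !mxE /= ?ji ?eqxx ?mul0r // addr0.
  rewrite big1 ?mul0r // => j mj; rewrite !mxE /=; case: eqP => [ji|].
    by rewrite -ji mj in mi.
  by rewrite mul0r.
have bu y : b u y = 0 by rewrite bd /mid eqxx mul0r.
have bw y : b w y = 0 by rewrite bd /mid eqxx andbF mul0r.
have mul0 x y : mul x y 0 ord0 = x 0 ord0 * y 0 ord0 by rewrite !mxE /=; ring.
have bm x y z : b x (mul y z) = y 0 ord0 * b x z + z 0 ord0 * b x y.
  rewrite bC /mul -[_ *: z + _ + _]addrA -[_ *: z + _ + _]addrA bl -addrA bl.
  rewrite -scaleNr bl -[_ *: w]addr0 bl bu bw !(bC x).
  have -> : b 0 x = 0 by apply: big1 => i _; rewrite mxE mul0r.
  by ring.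
have epsm x y : eps (mul x y) = mu * x 0 ord0 * y 0 ord0 + x 0 ord0 * y 0 ord_max
    + y 0 ord0 * x 0 ord_max + b x y.
  by rewrite /eps mul0 !mxE !eqxx /=; ring.
pose B := @ComFrobAlg k n.+2 mul u eps.
unshelve eexists (B _ _ _ _ _ _).
- by move=> a x1 x2 y /=; apply/rowP=> i; rewrite /mul bl !mxE; ring.
- by move=> x y /=; apply/rowP=> i; rewrite /mul bC !mxE; ring.
- move=> x y z /=; apply/rowP=> i; rewrite {1}/mul mul0 bm [mul (mul _ _) _]/mul.
  rewrite mul0 (bC (mul _ _)) bm !mxE (bC z x) (bC z y); ring.
- by move=> x /=; apply/rowP=> i; rewrite /mul bu !mxE /=; ring.
- by move=> a x y /=; rewrite /eps !mxE; ring.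
(* Pairing with [w], [u] and the middle vectors reads off the first, last and middle coordinates in
   turn. *)
- move=> x /= xP; have x0 : x 0 ord0 = 0.
    by have := xP w; rewrite epsm bC bw !mxE !eqxx /= !mulr0 mul0r !addr0 add0r mulr1.
  apply/rowP=> i; rewrite [RHS]mxE.
  case: (eqVneq i ord0) => [->//|i0].
  case: (eqVneq i ord_max) => [->|im].
    by have := xP u; rewrite epsm bC bu !mxE /= x0; move=> <-; ring.
  have := xP (delta_mx 0 i); rewrite epsm bC bd /mid i0 im !mxE /= eq_sym (negPf i0) x0.
  by move=> <-; rewrite (eq_sym _ i) (negPf im) /=; ring.
set C := B _ _ _ _ _ _.
(* The dual of [u] is [w], that of [w] is [u - mu *: w], and middle vectors are self-dual; each
   basis vector times its dual is [w]. *)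
pose v (j : 'I_n.+2) : V := if j == ord0 then w else
  if j == ord_max then u - mu *: w else delta_mx 0 j.
have m0 : (ord_max == ord0 :> 'I_n.+2) = false by [].
exists v; split.
  move=> i j; rewrite /= epsm bd /v.
  case: (eqVneq j ord0) => [->|j0]; [|case: (eqVneq j ord_max) => [->|jm]];
  (case: (eqVneq i ord0) => [->|i0]; [|case: (eqVneq i ord_max) => [->|im]]);
  rewrite /mid !mxE ?eqxx ?n0 ?m0 ?(negPf i0) ?(negPf j0) ?(negPf im) ?(negPf jm)
   ?(eq_sym ord0) ?(eq_sym ord_max) ?eqxx ?n0 ?m0
   ?(negPf i0) ?(negPf j0) ?(negPf im) ?(negPf jm) /=; try by ring.
have hE : handle (B := C) v = n.+2%:R *: w.
  rewrite /handle (eq_bigr (fun=> w)) /=.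
    by rewrite sumr_const card_ord scaler_nat.
  move=> i _; apply/rowP=> j; rewrite /mul bd /v /mid.
  case: (eqVneq i ord0) => [->|i0]; [|case: (eqVneq i ord_max) => [->|im]];
  rewrite !mxE ?eqxx ?n0 ?m0 ?(eq_sym ord0) ?eqxx ?(negPf i0) ?(negPf im) /=; by ring.
have ww : mul w w = 0.
  by apply/rowP=> j; rewrite /mul bw !mxE n0 /=; ring.
have wu : mul w u = w.
  by apply/rowP=> j; rewrite /mul bw !mxE n0 /=; ring.
have mulZ a x y : mul (a *: x) y = a *: mul x y.
  exact: (scalable_linear (fun a x1 x2 => @fmul_linl _ C a x1 x2 y)).
have mulC x y : mul x y = mul y x by exact: (@fmulC _ C).
rewrite hE => -[|[|g]].
- by rewrite /= /eps !mxE /=; ring.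
- by rewrite /= mulZ wu /eps !mxE !eqxx n0 /=; ring.
suff -> : fpow (B := C) (n.+2%:R *: w) g.+2 = 0.
  by rewrite [LHS]/= !mul0r addr0 feps0.
rewrite /fpow /=; elim: g => [|g IHg] /=.
  by rewrite !mulZ wu mulC mulZ ww !scaler0.
by rewrite IHg mulC; exact: (@fmul0 C).
Qed.

End Realizable.

(** * Signed counts of permutations by number of cycles *)

Section SignedCycleCount.
Variables (R : idomainType) (T : finType).
Implicit Types (A B : {set T}) (s t : {perm T}).

Lemma perm_onU1_fix A x s :
  x \notin A -> perm_on (x |: A) s && (s x == x) = perm_on A s.
Proof.
move=> xA; apply/andP/idP => [[/subsetP sA /eqP sx] | sA].
  apply/subsetP=> y; rewrite inE => sy; move: (sA y); rewrite !inE sy.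
  move/(_ isT)/orP=> [/eqP yx|//]; by rewrite yx sx eqxx in sy.
split; last by rewrite (out_perm sA).
by apply: subset_trans sA _; exact: subsetUr.
Qed.

(** Cycles are counted on all of [T]: each point outside [A] contributes a factor ['X]. *)
Definition signed_cycle_poly_on A : {poly R} :=
  \sum_(s : {perm T} | perm_on A s) (-1) ^+ s *: 'X^#|porbits s|.

(* Every permutation of x |: A is uniquely [tperm x y * t] with t supported on
   A, and for y in A the transposition merges the fixed point x of t into the
   cycle of y. *)
Lemma signed_cycle_poly_onU1 A x : x \notin A ->
  'X * signed_cycle_poly_on (x |: A) =
  signed_cycle_poly_on A * ('X - #|A|%:R%:P).
Proof.
move=> xA; rewrite /signed_cycle_poly_on.
rewrite (partition_big (fun s => (s^-1)%g x) (mem (x |: A))) /=; last first.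
  move=> s sA; rewrite -topredE /=; apply: contraT => yA.
  have := out_perm sA yA; rewrite permKV => e.
  by case/negP: yA; rewrite -e; exact: setU11.
rewrite mulr_sumr.
(* For [y] in [A] the transposition flips the sign and removes one cycle, which the leading ['X]
   restores. *)
have step y : y \in x |: A ->
    'X * \sum_(s : {perm T} | perm_on (x |: A) s && ((s^-1)%g x == y))
      (-1) ^+ s *: 'X^#|porbits s| =
    (if y == x then 'X else -1) * signed_cycle_poly_on A.
  have fx t : (((tperm x y * t)^-1)%g x == y) = (t x == x).
    by rewrite -(inj_eq (@perm_inj _ (tperm x y * t)%g)) permKV permM tpermR eq_sym.
  move=> yA; rewrite (reindex_inj (mulgI (tperm x y))) /=.
  rewrite [in RHS]/signed_cycle_poly_on !mulr_sumr.
  apply: eq_big => [t|t].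
    rewrite -(perm_onU1_fix _ xA); congr (_ && _).
      have tA : perm_on (x |: A) (tperm x y).
        apply/subsetP=> z; rewrite inE; case: tpermP => [-> _|-> _|_ _]; last by rewrite eqxx.
          by rewrite !inE eqxx.
        by [].
      apply/idP/idP => [H|]; last exact: perm_onM.
      by rewrite -[t](mulKg (tperm x y)) tpermV perm_onM.
    exact: fx.
  rewrite fx => /andP[_ /eqP tx]; rewrite odd_mul_tperm.
  have ox : porbit t x = [set x].
    apply/eqP; rewrite eq_sym eqEcard sub1set porbit_id cards1 /=.
    apply: (@leq_trans #|[set x]|); last by rewrite cards1.
    apply: subset_leq_card; apply/subsetP=> z /porbitP[i ->]; rewrite inE.
    by elim: i => [|i IHi]; rewrite ?expg0 ?perm1 // expgSr permM (eqP IHi) tx.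
  have := porbits_mul_tperm t x y => /=.
  rewrite porbit_sym ox inE (eq_sym y).
  case: (eqVneq x y) => [-> |xy] /=.
    by rewrite !addn0 => ->.
  rewrite addn1 (_ : 1.*2 = 2)%N // addn2 => -[] <-.
  have XS n : ('X^(n.+1) : {poly R}) = 'X * 'X^n by exact: exprS.
  by rewrite XS mulN1r -scalerAr; case: (odd_perm t) => /=;
     rewrite ?expr1 ?expr0 ?scaleN1r ?scale1r ?opprK.
rewrite (eq_bigr _ step) big_setU1 //= eqxx.
rewrite (eq_bigr (fun=> - signed_cycle_poly_on A)); last first.
  move=> y yA; case: eqP => [yx|_]; last by rewrite mulN1r.
  by rewrite yx (negPf xA) in yA.
rewrite sumr_const -/(signed_cycle_poly_on A) mulrBr mulrC polyCMn mulr_natr.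
by rewrite -mulNrn.
Qed.

(** Induction on [#|A|], removing one point at a time; for empty [A] only the identity remains, with
    [#|T|] cycles. *)
Lemma signed_cycle_poly_onE A : 'X^#|A| * signed_cycle_poly_on A =
  'X^#|T| * \prod_(i < #|A|) ('X - i%:R%:P).
Proof.
elim: {A}#|A| {-2}A (erefl #|A|) => [|n IHn] A cA.
  rewrite cA big_ord0 mulr1 mul1r; move/eqP: cA; rewrite cards_eq0 => /eqP ->.
  rewrite /signed_cycle_poly_on (big_pred1 1%g) => [|s].
    rewrite odd_perm1 scale1r; congr 'X^_.
    rewrite /porbits card_imset ?cardE // => x y /eqP; rewrite eq_porbit_mem.
    by case/porbitP=> i ->; rewrite expg1n perm1.
  apply/idP/eqP => [/perm_on_id|->]; last exact: perm_on1.
  by rewrite cards0; apply.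
have [x xA] : {x | x \in A} by apply/sigW/card_gt0P; rewrite cA.
have e : #|A :\ x| = n by move: cA; rewrite (cardsD1 x) xA => -[].
have := IHn _ e; rewrite e => H.
rewrite cA big_ord_recr /= mulrA -H exprSr -mulrA -mulrA.
have -> : signed_cycle_poly_on A = signed_cycle_poly_on (x |: A :\ x) by rewrite setD1K.
by rewrite signed_cycle_poly_onU1 ?e // !inE eqxx.
Qed.

Lemma signed_cycle_polyE :
  \sum_(s : {perm T}) (-1) ^+ s *: 'X^#|porbits s| =
  \prod_(i < #|T|) ('X - i%:R%:P) :> {poly R}.
Proof.
have := signed_cycle_poly_onE setT; rewrite cardsT => /mulfI; rewrite expf_neq0 ?polyX_eq0 // => <- //.
apply: eq_bigl => s; apply/esym/subsetP=> x _; exact: in_setT.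
Qed.

(* Multiplication by [tperm x y] exchanges the permutations with x and y in the
   same cycle and the others, changing the number of cycles by one. *)
Lemma signed_cycle_poly_linked (x y : T) : x != y ->
  (\sum_(s : {perm T} | x \in porbit s y) (-1) ^+ s *: 'X^#|porbits s|)
    * (1 - 'X) = \prod_(i < #|T|) ('X - i%:R%:P) :> {poly R}.
Proof.
move=> xy; rewrite -signed_cycle_polyE [RHS](bigID (fun s : {perm T} => x \in porbit s y)) /=.
rewrite mulrBr mulr1; congr (_ + _).
have sw (s : {perm T}) : (x \notin porbit (tperm x y * s)%g y) = (x \in porbit s y).
  have := porbits_mul_tperm s x y; have := porbits_mul_tperm (tperm x y * s)%g x y.
  rewrite /= mulgA tperm2 mul1g xy.
  case: (x \in porbit s y); case: (x \in porbit _ y) => //=; lia.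
rewrite [RHS](reindex_inj (mulgI (tperm x y))) /= mulr_suml -sumrN.
apply: eq_big => [s|s sxy]; first by rewrite sw.
have := porbits_mul_tperm s x y; rewrite /= sxy xy addn0 addn1 => ->.
rewrite odd_mul_tperm xy exprSr -scalerAl.
by case: (odd_perm s); rewrite /= ?expr1 ?expr0 ?scaleN1r ?scale1r ?opprK.
Qed.

End SignedCycleCount.

(** * Evaluations of the signed cycle counts *)

Section SignedCycleSums.
Variable k : fieldType.

Lemma signed_cycle_sum d (x : k) :
  \sum_(s : 'S_d) (-1) ^+ s * x ^+ #|porbits s| = \prod_(i < d) (x - i%:R).
Proof.
rewrite (eq_bigr (fun s : 'S_d => ((-1) ^+ s *: 'X^#|porbits s|).[x])); last first.
  by move=> s _; rewrite hornerZ hornerXn.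
rewrite -horner_sum signed_cycle_polyE horner_prod card_ord.
by apply: eq_bigr => i _; rewrite hornerXsubC.
Qed.

Lemma card_porbits_gt0 d (s : 'S_d.+1) : (0 < #|porbits s|)%N.
Proof. by apply/card_gt0P; exists (porbit s ord0); rewrite imset_f. Qed.

(** Cancelling ['X] between polynomials keeps the formula valid at [x = 0], where the sum retains
    only the permutations with one cycle. *)
Lemma signed_cycle_sum_pred d (x : k) :
  \sum_(s : 'S_d.+1) (-1) ^+ s * x ^+ #|porbits s|.-1 =
  \prod_(i < d) (x - i.+1%:R).
Proof.
have E : \sum_(s : 'S_d.+1) (-1) ^+ s *: 'X^(#|porbits s|.-1) =
    \prod_(i < d) ('X - i.+1%:R%:P) :> {poly k}.
  apply: (@mulfI _ 'X); rewrite ?polyX_eq0 // mulr_sumr.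
  have := signed_cycle_polyE k 'I_d.+1; rewrite card_ord big_ord_recl subr0.
  move=> <-; apply: eq_bigr => s _.
  by rewrite -scalerAr -exprS prednK ?card_porbits_gt0.
rewrite (eq_bigr (fun s : 'S_d.+1 => ((-1) ^+ s *: 'X^(#|porbits s|.-1)).[x])).
  by rewrite -horner_sum E horner_prod; apply: eq_bigr => i _; rewrite hornerXsubC.
by move=> s _; rewrite hornerZ hornerXn.
Qed.

(** Cancelling [1 - 'X] removes the root [1]; evaluation at [1] then leaves only the signs. *)
Lemma signed_linked_sum d (x y : 'I_d.+2) : x != y ->
  \sum_(s : 'S_d.+2 | x \in porbit s y) (-1) ^+ s =
  - \prod_(i < d) (- i.+1%:R) :> k.
Proof.
move=> xy; have E : \sum_(s : 'S_d.+2 | x \in porbit s y) (-1) ^+ s *: 'X^#|porbits s| =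
    - ('X * \prod_(i < d) ('X - i.+2%:R%:P)) :> {poly k}.
  apply: (@mulIf _ (1 - 'X)).
    by rewrite -opprB oppr_eq0 polyXsubC_eq0.
  rewrite signed_cycle_poly_linked // card_ord !big_ord_recl subr0.
  rewrite /= polyC1; set P := \prod_(i < d) _.
  transitivity ('X * (('X - 1) * P)); last by ring.
  by congr (_ * (_ * _)); exact: eq_bigr.
rewrite (eq_bigr (fun s : 'S_d.+2 => ((-1) ^+ s *: 'X^#|porbits s|).[1])); last first.
  by move=> s _; rewrite hornerZ hornerXn expr1n mulr1.
rewrite -horner_sum E hornerN hornerM hornerX mul1r horner_prod.
congr (- _); apply: eq_bigr => i _.
by rewrite hornerXsubC -[i.+2]add1n natrD opprD addrA subrr add0r.
Qed.

End SignedCycleSums.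

(** * Tubes with one cut strand *)

Section CutTubes.
Variables (d : nat) (w : 'I_d.+1 -> nat).

(* The endomorphism of d + 1 circles whose i-th strand is a tube of genus w i,
   except that strand 0 is cut into an incoming disc of genus w 0 and an
   outgoing disc: component [lift ord0 i] carries incoming circle i, and
   component [ord0] is the outgoing disc. *)
Definition cut_in (i : 'I_d.+1) (_ : 'I_1) : 'I_d.+2 := lift ord0 i.
Definition cut_out (i : 'I_d.+1) (_ : 'I_1) : 'I_d.+2 :=
  if i == ord0 then ord0 else lift ord0 i.
Definition cut_gen (u : 'I_d.+2) : nat :=
  if unlift ord0 u is Some i then w i else 0%N.
Definition cut_strand (u : 'I_d.+2) : 'I_d.+1 := odflt ord0 (unlift ord0 u).

Lemma cut_strand_lift i : cut_strand (lift ord0 i) = i.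
Proof. by rewrite /cut_strand liftK. Qed.

Lemma cut_strand_out i a : cut_strand (cut_out i a) = i.
Proof.
rewrite /cut_out; case: eqP => [->|_]; last exact: cut_strand_lift.
by rewrite /cut_strand unlift_none.
Qed.

Lemma connect_cut (s : 'S_d.+1) u v :
  connect (glue_rel cut_in cut_out s) u v =
  (porbit s (cut_strand u) == porbit s (cut_strand v)).
Proof.
set e := glue_rel _ _ _.
have esym : symmetric e.
  move=> x y; apply/existsP/existsP => -[i /existsP[a H]]; exists i;
  by apply/existsP; exists a; rewrite orbC.
have csym := sym_connect_sym esym.
have eout i : e (cut_out i ord0) (lift ord0 (s i)).
  by apply/existsP; exists i; apply/existsP; exists ord0; rewrite !eqxx.
have elift i : i != ord0 -> e (lift ord0 i) (lift ord0 (s i)).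
  by move=> i0; have := eout i; rewrite /cut_out (negPf i0).
have e0 : e ord0 (lift ord0 (s ord0)) by have := eout ord0; rewrite /cut_out eqxx.
(* Follow the cycle of strand 0 from the outgoing disc: either the incoming disc has been met, or
   the path continues, until the order of [s] forces a return. *)
have c0 : connect e ord0 (lift ord0 ord0).
  have H j : connect e ord0 (lift ord0 ord0) \/
             connect e ord0 (lift ord0 ((s ^+ j.+1)%g ord0)).
    elim: j => [|j [IHj|IHj]]; [right|by left|].
      by rewrite expg1 connect1.
    case: (eqVneq ((s ^+ j.+1)%g ord0) ord0) => [E|n0].
      by left; rewrite E in IHj.
    right; apply: connect_trans IHj _; rewrite (expgSr s j.+1) permM.
    by apply: connect1; exact: elift.
  case: (H #[s]%g.-1) => //; rewrite prednK ?order_gt0 // expg_order perm1 //.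
(* For the cut strand there is no direct edge; the path goes back round the cycle to the outgoing
   disc. *)
have cstep i : connect e (lift ord0 i) (lift ord0 (s i)).
  case: (eqVneq i ord0) => [->|i0]; last by rewrite connect1 ?elift.
  by rewrite csym in c0; apply: connect_trans c0 (connect1 e0).
have cs u' : connect e u' (lift ord0 (cut_strand u')).
  rewrite /cut_strand; case: (unliftP ord0 u') => [i ->|->] //=.
apply/idP/idP => [/connectP[p pp ->]|].
  elim: p u pp => [|z p IHp] x //= /andP[exz /IHp] => /eqP <- {IHp}.
  have stepO i : porbit s i = porbit s (s i).
    by have := porbit_perm s 1 i; rewrite expg1.
  case/existsP: exz => i /existsP[a /orP[]] /andP[/eqP <- /eqP <-];
    by rewrite cut_strand_out cut_strand_lift (stepO i).
rewrite eq_sym eq_porbit_mem => /porbitP[j E].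
apply: connect_trans (cs u) _; rewrite csym; apply: connect_trans (cs v) _.
rewrite E csym; elim: j {E} => [|j IHj]; first by rewrite perm1.
by apply: connect_trans IHj _; rewrite expgSr permM.
Qed.

Lemma glue_classes_cut (s : 'S_d.+1) : glue_classes cut_in cut_out s =
  [set cut_strand @^-1: (c : {set _}) | c in porbits s].
Proof.
apply/setP=> C; apply/imsetP/imsetP => [[u _ ->]|[_ /imsetP[i _ ->] ->]].
  exists (porbit s (cut_strand u)); first by rewrite imset_f.
  apply/setP=> v; rewrite !inE connect_cut eq_sym eq_porbit_mem //.
exists (lift ord0 i) => //; apply/setP=> v.
by rewrite !inE connect_cut cut_strand_lift eq_sym eq_porbit_mem.
Qed.

(** There are [#|c|] gluing circles and [#|c|] pieces, plus the extra disc if [ord0] lies in [c];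
    that disc cancels the handle made by closing the cycle. *)
Lemma glue_genus_cut (c : {set 'I_d.+1}) :
  glue_genus cut_out cut_gen (cut_strand @^-1: c) =
  ((ord0 \notin c) + \sum_(i in c) w i)%N.
Proof.
rewrite /glue_genus.
have -> : (\sum_(v in cut_strand @^-1: c) cut_gen v = \sum_(i in c) w i)%N.
  rewrite big_mkcond big_ord_recl /= {1}/cut_gen unlift_none if_same add0n.
  rewrite [RHS]big_mkcond; apply: eq_bigr => i _.
  by rewrite inE cut_strand_lift /cut_gen liftK.
have -> : #|[set ia : 'I_d.+1 * 'I_1 | cut_out ia.1 ia.2 \in cut_strand @^-1: c]|
    = #|c|.
  rewrite -[RHS]muln1 -[X in (_ * X)%N](card_ord 1) -[X in (_ * X)%N]cardsT -cardsX.
  by apply: eq_card => -[i a]; rewrite !inE cut_strand_out andbT.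
have -> : #|cut_strand @^-1: c| = ((ord0 \in c) + #|c|)%N.
  rewrite -!sum1_card big_mkcond big_ord_recl /= inE.
  rewrite {1}/cut_strand unlift_none /=; congr (_ + _)%N.
  rewrite [RHS]big_mkcond; apply: eq_bigr => i _.
  by rewrite inE cut_strand_lift.
by case: (_ \in c) => /=; lia.
Qed.

Lemma closure_eval_cut (k : fieldType) (alpha : nat -> k) (s : 'S_d.+1) :
  closure_eval alpha cut_in cut_out cut_gen s =
  \prod_(c in porbits s) alpha ((ord0 \notin c) + \sum_(i in c) w i)%N.
Proof.
rewrite /closure_eval glue_classes_cut big_imset /=.
  by apply: eq_bigr => c _; rewrite glue_genus_cut.
(* [cut_strand] is onto, so distinct cycles have distinct preimages. *)
move=> c c' _ _ /setP E; apply/setP=> i.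
by have := E (lift ord0 i); rewrite !inE cut_strand_lift.
Qed.

End CutTubes.

(** * Alternating sums over cycles *)

Lemma porbits_neq (T : finType) (s : {perm T}) (c : {set T}) x :
  c \in porbits s -> (c != porbit s x) = (x \notin c).
Proof.
by case/imsetP=> y _ ->; rewrite eq_sym eq_porbit_mem.
Qed.

Section AlternatingEvaluation.
Variables (k : fieldType) (d : nat) (L : {scalar {poly k}}).
Implicit Types (a : 'I_d.+1 -> {poly k}) (s : 'S_d.+1) (p : {poly k}).

(* Strand 0 is cut, so its cycle closes up to a sphere and the other cycles to
   tori, with the polynomials a_i in the handle operator inserted. *)
Definition cycle_eval a s : k :=
  \prod_(c in porbits s) L ('X^(ord0 \notin c) * \prod_(i in c) a i).

Definition alt_eval a : k := \sum_(s : 'S_d.+1) (-1) ^+ s * cycle_eval a s.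

Definition update a j p : 'I_d.+1 -> {poly k} :=
  fun i => if i == j then p else a i.

Lemma eq_alt_eval a b : a =1 b -> alt_eval a = alt_eval b.
Proof.
move=> ab; apply: eq_bigr => s _; congr (_ * _); apply: eq_bigr => c _.
by congr (L (_ * _)); apply: eq_bigr.
Qed.

Lemma cycle_eval_update a j p s : cycle_eval (update a j p) s =
  L (p * ('X^(ord0 \notin porbit s j) * \prod_(i in porbit s j | i != j) a i))
  * \prod_(c in porbits s | j \notin c)
      L ('X^(ord0 \notin c) * \prod_(i in c) a i).
Proof.
rewrite /cycle_eval (bigD1 (porbit s j)) ?imset_f //=; congr (_ * _).
  rewrite (bigD1 j) ?porbit_id //= /update eqxx mulrCA; congr (L (_ * (_ * _))).
  by apply: eq_bigr => i /andP[_ /negPf ->].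
apply: eq_big => [c|c /andP[cs]].
  by case: (boolP (c \in _)) => //= cs; rewrite porbits_neq.
rewrite porbits_neq // => jc; congr (L (_ * _)); apply: eq_bigr => i ic.
by rewrite /update; case: eqP => // ij; rewrite -ij ic in jc.
Qed.

(** Strand [j] lies in exactly one cycle, so each product is linear in the polynomial on [j]. *)
Lemma alt_eval_update_sum a j n (c : 'I_n -> k) (p : 'I_n -> {poly k}) :
  alt_eval (update a j (\sum_(l < n) c l *: p l)) =
  \sum_(l < n) c l * alt_eval (update a j (p l)).
Proof.
rewrite /alt_eval; under [RHS]eq_bigr => l _ do rewrite mulr_sumr.
rewrite exchange_big; apply: eq_bigr => s _ /=.
rewrite cycle_eval_update mulr_suml linear_sum mulr_suml mulr_sumr.
apply: eq_bigr => l _; rewrite cycle_eval_update -scalerAl linearZ /=.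
by rewrite -!mulrA mulrCA.
Qed.

Lemma alt_eval_monomials : (forall w : 'I_d.+1 -> nat, alt_eval (fun i => 'X^(w i)) = 0) ->
  forall a, alt_eval a = 0.
Proof.
move=> mon.
(* [r] lists the strands still to be expanded; off [r] the size of a monomial gives its exponent. *)
have H (r : seq 'I_d.+1) a :
    (forall i, i \notin r -> a i = 'X^((size (a i)).-1)) -> alt_eval a = 0.
  elim: r a => [|j r IHr] a ar.
    by rewrite -(mon (fun i => (size (a i)).-1)); apply: eq_alt_eval => i; exact: ar.
  have -> : alt_eval a =
      alt_eval (update a j (\sum_(l < size (a j)) (a j)`_l *: 'X^l)).
    apply: eq_alt_eval => i; rewrite /update; case: eqP => // ->.
    by rewrite -poly_def coefK.
  rewrite alt_eval_update_sum big1 // => l _; rewrite IHr ?mulr0 // => i ir.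
  rewrite /update; case: eqP => [_|/eqP ij]; first by rewrite size_polyXn.
  by apply: ar; rewrite inE negb_or ij.
by move=> a; apply: (H (enum 'I_d.+1)) => i; rewrite mem_enum.
Qed.

Lemma prod_marked (c : {set 'I_d.+1}) j p :
  \prod_(i in c) ('X^(i == j) * p) = 'X^(j \in c) * p ^+ #|c|.
Proof.
rewrite big_split prodr_const; congr (_ * _).
case: (boolP (j \in c)) => jc.
  rewrite (bigD1 j) //= eqxx big1 ?mulr1 // => i /andP[_ /negPf ->].
  by rewrite expr0.
by rewrite big1 // => i ic; case: eqP => [ij|//]; rewrite -ij ic in jc.
Qed.

Lemma card_porbits_pos s c : c \in porbits s -> (0 < #|c|)%N.
Proof. by case/imsetP=> x _ ->; rewrite lt0n card_porbit_neq0. Qed.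

(** The extra ['X] on strand 0 replaces the handle lost by cutting, so all cycles are treated
    alike. *)
Lemma cycle_eval_tubes p s : cycle_eval (fun i => 'X^(i == ord0) * p) s =
  \prod_(c in porbits s) L ('X * p ^+ #|c|).
Proof.
apply: eq_bigr => c _; rewrite prod_marked mulrA -exprD.
by case: (_ \in c); rewrite expr1.
Qed.

Hypothesis char0 : [pchar k] =i pred0.
Hypothesis alt0 : forall a, alt_eval a = 0.

Let natr_eq0 n : (n%:R == 0 :> k) = (n == 0)%N.
Proof. by move/pcharf0P: char0 => ->. Qed.

(* Cayley-Hamilton: q is read off from the vanishing of [alt_eval] at
   (p, X, ..., X). *)
Lemma annihilator_exists : exists2 q : {poly k}, q != 0 & forall p, L (q * p) = 0.
Proof.
(* With [p] on strand 0, the other strands of its cycle contribute the power of ['X]; [C s] collects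
   the remaining cycles. *)
pose C s := \prod_(c in porbits s | ord0 \notin c) L ('X * 'X^#|c|).
pose q := \sum_(s : 'S_d.+1) ((-1) ^+ s * C s) *: 'X^(#|porbit s ord0|.-1).
exists q; last first.
  move=> p; rewrite -[RHS](alt0 (update (fun=> 'X) ord0 p)) /alt_eval.
  rewrite mulr_suml linear_sum; apply: eq_bigr => s _.
  rewrite cycle_eval_update -scalerAl linearZ /= -mulrA; congr (_ * _).
  rewrite porbit_id expr0 mul1r mulrC; congr (_ * _).
    rewrite mulrC; congr (L (p * _)).
    rewrite (cardsD1 ord0) porbit_id /= -prodr_const; apply: eq_bigl => i.
    by rewrite !inE andbC.
  apply: eq_bigr => c /andP[_ /negPf c0].
  by rewrite c0 prodr_const.
(* Degree [d] is reached only by the full cycles, for which [C s = 1]; their indicator is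
   [0 ^+ #|porbits s|.-1]. *)
apply/eqP=> /(congr1 (coefp d)) /eqP; rewrite /= coef0; apply/negP.
rewrite coef_sum.
rewrite (eq_bigr (fun s : 'S_d.+1 => (-1) ^+ s * 0 ^+ #|porbits s|.-1)).
  rewrite signed_cycle_sum_pred; apply/prodf_neq0 => i _.
  by rewrite sub0r oppr_eq0 natr_eq0.
move=> s _; rewrite coefZ coefXn -mulrA; congr (_ * _).
case: (eqVneq (porbit s ord0) setT) => [E|nT].
  rewrite E cardsT card_ord eqxx mulr1.
  have PE : porbits s = [set setT].
    apply/setP=> c; rewrite inE; apply/imsetP/eqP => [[x _ ->]|->].
      by rewrite -E; apply/eqP; rewrite eq_porbit_mem E inE.
    by exists ord0.
  by rewrite PE cards1 expr0 /C big_pred0 // => c; rewrite PE in_set1; case: eqP => // ->; rewrite in_setT.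
have [x xP] : exists x, x \notin porbit s ord0.
  apply/existsP; apply: contraR (nT); rewrite negb_exists => /forallP aT.
  by apply/eqP/setP=> x; rewrite inE; move: (aT x); rewrite negbK.
have -> : (d == #|porbit s ord0|.-1) = false.
  have : (#|porbit s ord0| < #|[set: 'I_d.+1]|)%N.
    by apply: proper_card; rewrite properEneq nT subsetT.
  rewrite cardsT card_ord => H; apply/negbTE.
  by have := card_porbit_neq0 s ord0; lia.
have : (1 < #|porbits s|)%N.
  apply/card_gt1P; exists (porbit s x), (porbit s ord0).
  by rewrite !imset_f // eq_porbit_mem.
by case: #|_| => [|[|n]] //= _; rewrite mulr0 exprS mul0r.
Qed.

(** Otherwise take the last power [y] of [z] with [L ('X * y) != 0]. Any cycle of length at least 2
    then evaluates to 0, so only the identity survives and a power of [L ('X * y)] vanishes. *)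
Lemma trace_nilpotent z N : (forall p, L (z ^+ N * p) = 0) -> L ('X * z) = 0.
Proof.
move=> zN; apply/eqP/contraT => nz.
pose P i := (0 < i)%N && (L ('X * z ^+ i) != 0).
have exP : exists i, P i by exists 1%N; rewrite /P expr1.
have bP i : P i -> (i <= N)%N.
  case/andP=> _; apply: contraR; rewrite -ltnNge => Ni.
  by rewrite -(subnK (ltnW Ni)) exprD mulrA mulrC zN.
case: (ex_maxnP exP bP) => m /andP[m0 nzm] maxm.
pose y := z ^+ m.
have y2 l : (1 < l)%N -> L ('X * y ^+ l) = 0.
  move=> l1; apply/eqP/contraT => nzl; rewrite -exprM in nzl.
  have /maxm : P (m * l)%N by rewrite /P muln_gt0 m0 nzl (ltnW l1).
  by rewrite leqNgt ltn_Pmulr.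
have := alt0 (fun i => 'X^(i == ord0) * y).
rewrite /alt_eval (bigD1 1%g) //= big1 ?addr0 => [|s s1]; last first.
  have [x sx] : exists x, s x != x.
    apply/existsP; apply: contraR s1; rewrite negb_exists => /forallP s1.
    by apply/eqP/permP=> x; apply/eqP; rewrite perm1; move: (s1 x); rewrite negbK.
  rewrite cycle_eval_tubes (bigD1 (porbit s x)) ?imset_f //= y2 ?mul0r ?mulr0 //.
  apply/card_gt1P; exists (s x), x; rewrite porbit_id; split=> //.
  by have := mem_porbit s 1 x; rewrite expg1.
rewrite cycle_eval_tubes odd_perm1 expr0 mul1r => /eqP; rewrite prodf_seq_eq0.
case/hasP=> c _ /andP[/imsetP[x _ ->]].
have -> : porbit 1%g x = [set x].
  apply/setP=> z'; rewrite inE; apply/porbitP/eqP => [[i ->]|->].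
    by rewrite expg1n perm1.
  by exists 0%N; rewrite perm1.
by rewrite cards1 expr1 (negPf nzm).
Qed.

(** Every cycle evaluates to [t], so the alternating sum is the product of the [t - i%:R]. *)
Lemma trace_idempotent e t : (forall l, L ('X * e ^+ l.+1) = t) ->
  exists i : 'I_d.+1, t == i%:R.
Proof.
move=> et; have := alt0 (fun i => 'X^(i == ord0) * e).
rewrite /alt_eval (eq_bigr (fun s : 'S_d.+1 => (-1) ^+ s * t ^+ #|porbits s|)).
  rewrite signed_cycle_sum => /eqP; rewrite prodf_seq_eq0.
  by case/hasP=> i _ /andP[_]; rewrite subr_eq0; exists i.
move=> s _; rewrite cycle_eval_tubes -prodr_const; congr (_ * _).
by apply: eq_bigr => c /card_porbits_pos; case: #|c| => // n _.
Qed.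


End AlternatingEvaluation.

(** * Classification *)

(** Newton interpolation; the denominator is nonzero when the nodes are distinct. *)
Fixpoint interpolant (k : fieldType) (r : seq k) (f : k -> k) : {poly k} :=
  if r is y :: r' then
    let p := interpolant r' f in let N := \prod_(z <- r') ('X - z%:P) in
    p + ((f y - p.[y]) / N.[y]) *: N
  else 0.

Lemma interpolantE (k : fieldType) (r : seq k) (f : k -> k) :
  uniq r -> {in r, forall x, (interpolant r f).[x] = f x}.
Proof.
elim: r => //= y r IHr /andP[yr ur] x; rewrite inE hornerD hornerZ.
case: (eqVneq x y) => [-> _|_ /= xr].
  rewrite divfK; first by rewrite addrC subrK.
  by have := root_prod_XsubC r y; rewrite (negPf yr) => /negbT.
have /rootP -> : root (\prod_(z <- r) ('X - z%:P)) x by rewrite root_prod_XsubC.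
by rewrite mulr0 addr0 IHr.
Qed.

Lemma dvdp_prod_XsubC_exp (k : fieldType) (rs r : seq k) : {subset rs <= r} ->
  \prod_(z <- rs) ('X - z%:P) %| (\prod_(z <- r) ('X - z%:P)) ^+ size rs.
Proof.
elim: rs => [|z rs IHrs] sr; first by rewrite big_nil dvd1p.
rewrite big_cons exprS dvdp_mul //.
  by rewrite dvdp_XsubCl root_prod_XsubC sr ?mem_head.
by apply: IHrs => x xr; apply: sr; rewrite inE xr orbT.
Qed.

Section Classification.
Variables (k : closedFieldType) (d : nat) (L : {scalar {poly k}}).
Hypothesis char0 : [pchar k] =i pred0.
Hypothesis alt0 : forall a : 'I_d.+1 -> {poly k}, alt_eval L a = 0.

(* [p |-> L (X p)] is the trace of p(handle operator): it kills the radical of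
   the annihilator, so it is a combination of evaluations, and its values on
   the Lagrange idempotents are natural numbers. *)
Lemma trace_is_sum_of_evaluations : exists (r : seq k) (m : k -> nat),
  [/\ uniq r, 0 \in r, (forall x, (m x <= d)%N) &
      forall p, L ('X * p) = \sum_(x <- r) (m x)%:R * p.[x]].
Proof.
have [q nzq qL] := annihilator_exists char0 alt0.
have [rs qE] := closed_field_poly_normal q.
(* The node 0 is adjoined even if it is not a root of [q], since it carries [m] and [mu] later. *)
pose r := undup (0 :: rs); have ur : uniq r by exact: undup_uniq.
pose R := \prod_(z <- r) ('X - z%:P).
(* [q] divides a power of [R], so [R * p] is nilpotent modulo [q]. *)
have RL p : L ('X * (R * p)) = 0.
  apply: (trace_nilpotent alt0 (N := size rs)) => u.
  rewrite exprMn.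
  suff /dvdpP[v ->] : q %| R ^+ size rs.
    by rewrite -!mulrA mulrCA qL.
  rewrite qE dvdpZl ?lead_coef_eq0 //.
  apply: dvdp_prod_XsubC_exp => z zr.
  by rewrite mem_undup inE zr orbT.
have vanish p : {in r, forall x, p.[x] = 0} -> L ('X * p) = 0.
  move=> p0; have /dvdpP[v ->] : R %| p; last by rewrite [v * _]mulrC RL.
  apply: uniq_roots_dvdp; last by rewrite uniq_rootsE.
  by apply/allP=> x xr; apply/rootP; exact: p0.
pose lag x := interpolant r (fun y => (y == x)%:R).
have lagE x y : y \in r -> (lag x).[y] = (y == x)%:R.
  by move=> yr; rewrite interpolantE.
pose t x := L ('X * lag x).
have tE x : exists i : 'I_d.+1, t x == i%:R.
  (* Powers of [lag x] agree with [lag x] on [r], hence have the same trace. *)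
  apply: (trace_idempotent alt0 (e := lag x)) => l; apply/eqP.
  rewrite -subr_eq0 -linearB /= -mulrBr vanish // => y yr.
  by rewrite hornerD hornerN horner_exp lagE //; case: eqP => _; rewrite ?expr1n ?expr0n subrr.
(* By [tE] the default is never taken; the index type supplies the bound [d]. *)
exists r, (fun x => if [pick i : 'I_d.+1 | t x == i%:R] is Some i then (i : nat) else 0%N).
split=> //.
- by rewrite mem_undup mem_head.
- by move=> x; case: pickP => // i _; rewrite -ltnS.
move=> p; apply/eqP; rewrite -subr_eq0.
have -> : \sum_(x <- r) (if [pick i : 'I_d.+1 | t x == i%:R] is Some i then (i : nat)
      else 0%N)%:R * p.[x] = L ('X * \sum_(x <- r) p.[x] *: lag x).
  rewrite mulr_sumr linear_sum; apply: eq_bigr => x _.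
  rewrite -scalerAr linearZ /= mulrC; congr (_ * _).
  case: pickP => [i /eqP//|nt]; by have [i] := tE x; rewrite nt.
rewrite -linearB -mulrBr; apply/eqP/vanish => y yr.
rewrite hornerD hornerN horner_sum (bigD1_seq y) //= hornerZ lagE // eqxx mulr1.
rewrite big1 ?addr0 ?subrr // => x xy; rewrite hornerZ lagE // eq_sym.
by rewrite (negPf xy) mulr0.
Qed.

Lemma eval_form : exists (mu : k) (m : nat) (s : seq (nat * k)),
  [/\ (m == 0)%N && (mu == 0) || (2 <= m)%N, geom_data_ok s &
      forall g, L 'X^g =
        (g == 0%N)%:R * mu + (g == 1%N)%:R * m%:R + geom_part s g].
Proof.
have [r [m [ur r0 md LX]]] := trace_is_sum_of_evaluations.
(* The traces determine [L 'X^g] only for [g > 0]; [mu] is the remaining discrepancy at [g = 0]. *)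
pose mu := L 1 - \sum_(x <- r | x != 0) (m x)%:R / x.
pose s := [seq (m x, x) | x <- r & (x != 0) && (0 < m x)%N].
have geoE g : geom_part s g = \sum_(x <- r | x != 0) (m x)%:R / x * x ^+ g.
  rewrite /geom_part big_map big_filter /= big_mkcondr; apply: eq_bigr => x _.
  by case: posnP => // ->; rewrite !mul0r.
exists mu, (m 0), s; split; last first.
- case=> [|g].
    rewrite geoE mul1r mul0r addr0 /mu expr0.
    under [X in _ = _ + X]eq_bigr => x _ do rewrite expr0 mulr1.
    by rewrite subrK.
  rewrite exprS LX geoE mul0r add0r (bigD1_seq 0) //= hornerXn; congr (_ + _).
    by case: g => [|g]; rewrite ?expr0 ?mulr1 ?mul1r // exprS !mul0r mulr0.
  by apply: eq_bigr => x x0; rewrite hornerXn exprS mulrA divfK.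
- apply/allP=> p /mapP[x]; rewrite mem_filter => /andP[/andP[x0 mx] _] ->.
  by rewrite /= mx x0.
(* On [r], [e] is the indicator of 0. *)
pose u := interpolant r (fun x => x ^- 2); pose e := 1 - 'X ^+ 2 * u.
have e0 : e.[0] = 1.
  by rewrite /e hornerD hornerN hornerM hornerXn hornerC expr0n mul0r subr0.
have ex x : x \in r -> x != 0 -> e.[x] = 0.
  move=> xr x0; rewrite /e hornerD hornerN hornerM hornerXn hornerC.
  by rewrite interpolantE // divff ?subrr // expf_neq0.
have LXe l : L ('X * e ^+ l.+1) = (m 0)%:R.
  rewrite LX (bigD1_seq 0) //= big_seq_cond big1 ?addr0; last first.
    by move=> x /andP[xr x0]; rewrite horner_exp ex // expr0n mulr0.
  by rewrite horner_exp e0 expr1n mulr1.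
have LXXe l : L ('X * ('X * e ^+ l.+1)) = 0.
  rewrite LX big_seq big1 // => x xr; rewrite hornerM hornerX horner_exp.
  case: (eqVneq x 0) => [->|x0]; first by rewrite mul0r mulr0.
  by rewrite ex // expr0n !mulr0.
have eX l : exists v, e ^+ l = 1 - 'X ^+ 2 * v.
  elim: l => [|l [v IHl]]; first by exists 0; rewrite mulr0 subr0.
  by exists (u + v - 'X ^+ 2 * u * v); rewrite exprS IHl /e; ring.
(* The square of ['X] leaves the trace of ['X * v], where node 0 drops out; at any other node [x] of
   [r], [v.[x] = x ^- 2]. *)
have Le l : L (e ^+ l.+1) = mu.
  have [v ev] := eX l.+1; rewrite ev linearB /=; congr (_ - _).
  rewrite expr2 -mulrA LX (bigD1_seq 0) //= hornerM hornerX mul0r mulr0 add0r.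
  rewrite big_seq_cond [RHS]big_seq_cond; apply: eq_bigr => x /andP[xr x0].
  congr (_ * _); have := congr1 (horner^~ x) ev.
  rewrite horner_exp ex // expr0n /= hornerD hornerN hornerM hornerXn hornerC.
  move/eqP; rewrite eq_sym subr_eq0 => /eqP H; apply: (mulfI x0).
  by rewrite mulfV // hornerM hornerX mulrA -expr2 -H.
have natr_eq0 n : (n%:R == 0 :> k) = (n == 0)%N by move/pcharf0P: char0 => ->.
case m0: (m 0) => [|[|n]] //.
  rewrite eqxx /= orbF.
  (* The cycle of [ord0] gives [mu] and any other gives [m 0 = 0], so only full cycles count. *)
  have := alt0 (fun=> e); rewrite /alt_eval.
  rewrite (eq_bigr (fun s : 'S_d.+1 => mu * ((-1) ^+ s * 0 ^+ #|porbits s|.-1))).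
    rewrite -mulr_sumr signed_cycle_sum_pred => /eqP; rewrite mulf_eq0.
    case/orP=> // /prodf_eq0[i _].
    by rewrite sub0r oppr_eq0 natr_eq0.
  move=> p _; rewrite mulrCA; congr (_ * _).
  rewrite /cycle_eval (bigD1 (porbit p ord0)) ?imset_f //=.
  rewrite porbit_id mul1r prodr_const.
  have := card_porbit_neq0 p ord0; case: #|porbit p ord0| => // l _.
  rewrite Le; congr (_ * _).
  rewrite (cardsD1 (porbit p ord0)) imset_f //= -prodr_const.
  apply: eq_big => [c|c /andP[cp]]; first by rewrite !inE andbC.
  rewrite porbits_neq // => ->; rewrite prodr_const expr1.
  by have := card_porbits_pos cp; case: #|c| => // l' _; rewrite LXe m0.
(* If [m 0 = 1], the bound [m 0 <= d] provides a second strand. *)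
suff H n : (forall a : 'I_n.+1 -> {poly k}, alt_eval L a = 0) -> (0 < n)%N -> False.
  by case: (H d) => //; have := md 0; rewrite m0.
case: n => // n altn _.
pose a (i : 'I_n.+2) := 'X^(i == ord_max) * e.
have nm : ord_max != ord0 :> 'I_n.+2 by [].
have := altn a; rewrite /alt_eval (bigID (fun p : 'S_n.+2 => ord_max \in porbit p ord0)) /=.
(* If [ord_max] is not in the cycle of [ord0], its cycle carries two factors ['X] and vanishes by
   [LXXe]. *)
rewrite [X in _ + X]big1 ?addr0; last first.
  move=> p mp; apply/eqP; rewrite mulf_eq0; apply/orP; right.
  rewrite /cycle_eval (bigD1 (porbit p ord_max)) ?imset_f //= prod_marked.
  rewrite porbit_sym mp porbit_id !expr1.
  have := card_porbit_neq0 p ord_max; case: #|porbit p ord_max| => // l _.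
  by rewrite LXXe mul0r.
(* Otherwise every cycle carries exactly one ['X] and evaluates to [m 0 = 1]. *)
rewrite (eq_bigr (fun p : 'S_n.+2 => (-1) ^+ p)); last first.
  move=> p mp; rewrite -[RHS]mulr1; congr (_ * _); apply: big1 => c cp.
  rewrite prod_marked; have cE : (ord_max \in c) = (ord0 \in c).
    case/imsetP: cp => x _ ->; rewrite -!eq_porbit_mem.
    by move: mp; rewrite -eq_porbit_mem => /eqP ->.
  rewrite cE mulrA -exprD.
  have := card_porbits_pos cp; case: #|c| => // l _.
  by case: (ord0 \in c); rewrite expr1 LXe m0.
rewrite signed_linked_sum // => /eqP; rewrite oppr_eq0 => /prodf_eq0[i _].
by rewrite oppr_eq0 natr_eq0.
Qed.


End Classification.

(** * Linear extension of the evaluation, and assembly of the Frobenius algebra *)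

Section LinearExtension.
Variables (k : fieldType) (alpha : nat -> k).

Definition linear_eval (p : {poly k}) : k := \sum_(i < size p) p`_i * alpha i.

Lemma linear_eval_widen n (p : {poly k}) : (size p <= n)%N ->
  linear_eval p = \sum_(i < n) p`_i * alpha i.
Proof.
move=> pn; rewrite /linear_eval (big_ord_widen n (fun i => p`_i * alpha i)) //.
rewrite big_mkcond; apply: eq_bigr => i _; case: ltnP => // pi.
by rewrite nth_default // mul0r.
Qed.

Lemma linear_eval_is_scalar : scalar linear_eval.
Proof.
move=> c p q; pose n := maxn (size (c *: p + q)) (maxn (size p) (size q)).
rewrite !(@linear_eval_widen n); try by rewrite /n; lia.
rewrite mulr_sumr -big_split; apply: eq_bigr => i _ /=.
by rewrite coefD coefZ; ring.
Qed.

HB.instance Definition _ :=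
  GRing.isLinear.Build k {poly k} k *%R linear_eval linear_eval_is_scalar.

Lemma linear_evalXn g : linear_eval 'X^g = alpha g.
Proof.
rewrite (@linear_eval_widen g.+1) ?size_polyXn // big_ord_recr /= big1.
  by rewrite coefXn eqxx mul1r add0r.
by move=> i _; rewrite coefXn ltn_eqF ?mul0r.
Qed.

Lemma alt_vanishes_alt_eval d : alt_vanishes alpha 1 d ->
  forall a : 'I_d.+1 -> {poly k}, alt_eval linear_eval a = 0.
Proof.
move=> av; apply: alt_eval_monomials => w.
rewrite -[RHS](av _ (@cut_in d) (@cut_out d) (cut_gen w)).
apply: eq_bigr => s _; rewrite closure_eval_cut; congr (_ * _).
by apply: eq_bigr => c _; rewrite prodrXr -exprD; exact: linear_evalXn.
Qed.

Lemma frob_realizable_geom (s : seq (nat * k)) :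
  geom_data_ok s -> frob_realizable (geom_part s).
Proof.
elim: s => [_|[m x] s IHs /= /andP[/andP[_ x0] /IHs rs]].
  apply: frob_realizable_ext (frob_realizable0 k) => g.
  by rewrite /geom_part big_nil.
suff rm : frob_realizable (fun g => m%:R * (x^-1 * x ^+ g)).
  apply: frob_realizable_ext (frob_realizableD rm rs) => g.
  by rewrite /geom_part big_cons mulrA.
elim: m => [|m IHm].
  by apply: frob_realizable_ext (frob_realizable0 k) => g; rewrite mul0r.
apply: frob_realizable_ext (frob_realizableD (frob_realizable1 x0) IHm) => g.
by rewrite -[m.+1]add1n natrD mulrDl mul1r.
Qed.

End LinearExtension.

Theorem mainTheorem14 (k : closedFieldType) (hchar : [pchar k] =i pred0)
    (alpha : nat -> k) (hpc : pseudocharacter alpha) :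
  (Z_form1 alpha \/ Z_form2 alpha) /\
  exists (B : comFrobAlg k) (v : 'I_(fdim B) -> 'rV[k]_(fdim B)),
    is_dual_basis v /\
    forall g : nat, alpha g = feps (fpow (handle v) g).
Proof.
have [d /alt_vanishes_alt_eval av] := hpc 1%N.
have [mu [m [s [mP sP aE]]]] := eval_form hchar av.
have {}aE g : alpha g = (g == 0)%N%:R * mu + (g == 1)%N%:R * m%:R + geom_part s g.
  by rewrite -aE; exact/esym/linear_evalXn.
have rs := frob_realizable_geom sP.
case/orP: mP => [/andP[/eqP m0 /eqP mu0] | m2].
  have {}aE g : alpha g = geom_part s g.
    by rewrite aE m0 mu0 !mulr0 !add0r.
  split; first by right; exists s.
  exact: (frob_realizable_ext (fun g => esym (aE g)) rs).
split; first by left; exists mu, m, s.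
(* The local factor has [m.-2] middle vectors, so that its handle element is [m] times the socle
   generator. *)
apply: (@frob_realizable_ext _ _ alpha _ (frob_realizableD (frob_realizable_local mu m.-2) rs)).
by move=> g; rewrite aE; case: m m2 {aE} => [|[|]].
Qed.
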